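(* Suppose $p=p(n)$ satisfies $n^{-2}\ll1-p\le(D+o(1))/n$ for some constant $D\in(0,\infty)$, and set $q:=1-p$. Let $\varepsilon>0$ and let $\omega=\omega(n)\to\infty$ as $n\to\infty$. Then: (i) there is an interval of length $\lfloor\omega n\sqrt{q}\rfloor$ that contains $\chi(G_{n,p})$ with high probability; (ii) there is a constant $c=c(\varepsilon,D)>0$ such that no interval of length $\lfloor cn\sqrt{q}\rfloor$ contains $\chi(G_{n,p})$ with probability at least $\varepsilon+o(1)$, i.e., for every sequence of intervals $I_n$ of length $\lfloor cn\sqrt q\rfloor$ one has $\Pr(\chi(G_{n,p})\in I_n)\le\varepsilon+o(1)$.
   Context: $G_{n,p}$ denotes the binomial random graph on vertex set $[n]$ in which each pair of vertices is an edge independently with probability $p$; $\chi$ denotes the chromatic number. For positive functions, $a\ll b$ means $a/b\to0$ as $n\to\infty$; $o(1)$ denotes a quantity tending to $0$ as $n\to\infty$. ''With high probability'' means with probability tending to $1$. ''There is an interval of length $\ell(n)$ that contains $\chi(G_{n,p})$ with high probability'' means there exist intervals $I_n$ of length $\ell(n)$ with $\Pr(\chi(G_{n,p})\in I_n)\to1$. *)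

(* Defs.v *)
From HB Require Import structures.
From mathcomp Require Import all_boot all_order all_algebra.
From mathcomp Require Import all_classical all_reals all_analysis.
Set Implicit Arguments. Unset Strict Implicit. Unset Printing Implicit Defensive.
Import Order.TTheory GRing.Theory Num.Theory numFieldNormedType.Exports.
Local Open Scope ring_scope. Local Open Scope classical_set_scope.

(* A graph on [n] = 'I_n is encoded by a set E of ordered pairs; the relevant
   pairs are those (i,j) with i < j.  G(n,p) is the distribution on subsets
   of [upairs n]. *)
Definition upairs (n : nat) : {set 'I_n * 'I_n} := [set e : 'I_n * 'I_n | (val e.1 < val e.2)%N].

Definition adj n (E : {set 'I_n * 'I_n}) (i j : 'I_n) : bool :=
  (i != j) && (((i, j) \in E) || ((j, i) \in E)).

Definition colorable n (E : {set 'I_n * 'I_n}) (k : nat) : bool :=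
  [exists f : {ffun 'I_n -> 'I_k}, [forall i, forall j, adj E i j ==> (f i != f j)]].

Lemma colorable_n n (E : {set 'I_n * 'I_n}) : exists k, colorable E k.
Proof.
exists n; apply/existsP; exists [ffun i => i]; apply/forallP => i; apply/forallP => j.
by apply/implyP => /andP[ij _]; rewrite !ffunE.
Qed.

Definition chi n (E : {set 'I_n * 'I_n}) : nat := ex_minn (colorable_n E).

(* probability of the graph E in G(n,p) (E is assumed to be a subset of upairs n) *)
Definition Gnp_weight (R : realType) n (p : R) (E : {set 'I_n * 'I_n}) : R :=
  p ^+ #|E| * (1 - p) ^+ (#|upairs n| - #|E|).

Definition Gnp_Pr (R : realType) n (p : R) (A : pred {set 'I_n * 'I_n}) : R :=
  \sum_(E : {set 'I_n * 'I_n} | (E \subset upairs n) && A E) Gnp_weight p E.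

Definition Pr_chi_in (R : realType) (n : nat) (p : R) (a len : nat) : R :=
  Gnp_Pr (n := n) p (fun E : {set 'I_n * 'I_n} => (a <= chi E <= a + len)%N).

Definition regime (R : realType) (D : R) (p : nat -> R) : Prop :=
  (forall n, 0 <= p n <= 1) /\
  ((fun n => (n%:R) ^+ 2 * (1 - p n)) @ \oo --> +oo%R) /\
  (exists delta : nat -> R, delta @ \oo --> 0 /\
     \forall n \near \oo, (1 - p n) * n%:R <= D + delta n).

(* Main.v *)
Require Import Defs.
From HB Require Import structures.
From mathcomp Require Import all_boot all_order all_algebra.
From mathcomp Require Import all_classical all_reals all_analysis.
(* [fintype] and [finset] come last so that [set0], [subsetP], [setU1K], etc.
   denote the finite-set versions rather than the classical ones. *)
From mathcomp Require Import fintype finset ring lra zify.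
Set Implicit Arguments. Unset Strict Implicit. Unset Printing Implicit Defensive.
Import Order.TTheory GRing.Theory Num.Theory numFieldNormedType.Exports.
Local Open Scope ring_scope.

(** Let [q = 1 - p] and [s = n * sqrt q]. Changing one edge changes the chromatic
    number by at most one, so Efron-Stein bounds its variance by [s^2], and (i) is
    Chebyshev's inequality.

    For (ii), let [X] be the number of edges of the complement graph that form a
    component, and [T] the number of pairs of isolated vertices of the complement.
    Moving such an edge in or out of the graph changes the chromatic number by
    exactly one, whence for every [h]
      [q * E[T h(chi)] = p * E[X h(chi + 1)]].
    Write [tau] for the common mean of [q T] and [p X]. Taking
    [h k = min(k - a, L + 1)], whose increments are the indicator of [a, a + L],
    gives
      [tau * Pr(a <= chi <= a + L) <= (L + 1) (E|q T - tau| + E|p X - tau|)].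
    By Efron-Stein both deviations are [O(s)], because an edge affects [X] by [O(1)]
    and [T] by [O(n)] while [q n = O(1)]; and [tau] is of order [s^2]. Hence the
    probability is [O((L + 1) / s)]. *)

(** * Expectation over a binomial random subset of a finite set *)

Definition bmean (R : realFieldType) (T : finType) (p : R) (S : {set T})
    (F : {set T} -> R) : R :=
  \sum_(E : {set T} | E \subset S) p ^+ #|E| * (1 - p) ^+ (#|S| - #|E|) * F E.

Section BinomialSubset.
Context {R : realFieldType} {T : finType}.
Implicit Types (p : R) (S E B : {set T}) (F G : {set T} -> R).

(** Conditioning on whether [f] is present. Together with [finset_ind] this allows proofs that add
    one coordinate at a time, which is why [S] is an arbitrary finite set. *)
Lemma bmean_split p S f F : f \notin S ->
  bmean p (f |: S) F =
  p * bmean p S (fun E => F (f |: E)) + (1 - p) * bmean p S F.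
Proof.
move=> fS; rewrite /bmean (bigID (fun E : {set T} => f \in E)) /=; congr (_ + _).
  rewrite (reindex_onto (fun E => f |: E) (fun E => E :\ f)) /=; last first.
    by move=> E /andP[_ fE]; rewrite setD1K.
  rewrite mulr_sumr; apply: eq_big => [E|E].
    rewrite setU11 andbT; apply/andP/idP => [[sE /eqP EE]|sE].
      by rewrite -EE; apply/subsetP => x; rewrite !inE => /andP[xf];
         move/subsetP: sE => /(_ x); rewrite !inE (negbTE xf) /= => h /h.
    have fE : f \notin E by apply: contra fS; exact: (subsetP sE).
    split; first by rewrite setUS.
    by rewrite setU1K.
  move=> /andP[_ /eqP EE].
  have fE : f \notin E by rewrite -EE !inE eqxx.
  by rewrite !cardsU1 fE fS !add1n subSS exprS !mulrA.
rewrite mulr_sumr; apply: eq_big => [E|E /andP[sE fE]].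
  apply/andP/idP => [[sE fE]|sE].
    apply/subsetP => x xE; move/subsetP: sE => /(_ x xE).
    by rewrite !inE => /orP[/eqP xf|//]; rewrite -xf xE in fE.
  split; first by rewrite subsetU // sE orbT.
  by apply: contra fS; exact: (subsetP sE).
have sES : E \subset S.
  apply/subsetP => x xE; move/subsetP: sE => /(_ x xE).
  by rewrite !inE => /orP[/eqP xf|//]; rewrite -xf xE in fE.
rewrite cardsU1 fS add1n subSn ?subset_leq_card // exprS; ring.
Qed.

Lemma finset_ind (P : {set T} -> Prop) :
  P set0 -> (forall f S, f \notin S -> P S -> P (f |: S)) -> forall S, P S.
Proof.
move=> P0 PS S; move: {2}#|S| (erefl #|S|) => m; elim: m S => [|m IH] S.
  by move/eqP; rewrite cards_eq0 => /eqP ->.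
move=> cS; have /card_gt0P[f fS] : (0 < #|S|)%N by rewrite cS.
rewrite -(setD1K fS); apply: PS; first by rewrite !inE eqxx.
by apply: IH; move: cS; rewrite (cardsD1 f) fS add1n => -[].
Qed.

Lemma bmean_set0 p F : bmean p set0 F = F set0.
Proof.
rewrite /bmean (big_pred1 set0) => [|E]; last by rewrite subset0.
by rewrite cards0 !expr0 !mul1r.
Qed.

Lemma eq_bmean p S F G : (forall E, E \subset S -> F E = G E) ->
  bmean p S F = bmean p S G.
Proof. by move=> FG; apply: eq_bigr => E /FG ->. Qed.

Lemma bmeanD p S F G : bmean p S (fun E => F E + G E) = bmean p S F + bmean p S G.
Proof. by rewrite /bmean -big_split; apply: eq_bigr => E _; rewrite mulrDr. Qed.

Lemma bmeanZ p S k F : bmean p S (fun E => k * F E) = k * bmean p S F.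
Proof. by rewrite /bmean mulr_sumr; apply: eq_bigr => E _; rewrite mulrCA. Qed.

Lemma bmean_sum (I : Type) (r : seq I) (P : pred I) p S (F : I -> {set T} -> R) :
  bmean p S (fun E => \sum_(i <- r | P i) F i E) = \sum_(i <- r | P i) bmean p S (F i).
Proof.
by rewrite /bmean exchange_big /=; apply: eq_bigr => E _; rewrite mulr_sumr.
Qed.

Lemma bmean_cst p S k : bmean p S (fun=> k) = k.
Proof.
elim/finset_ind: S => [|f S fS IH]; first exact: bmean_set0.
by rewrite bmean_split // IH -mulrDl addrC subrK mul1r.
Qed.

Lemma ler_bmean p S F G : 0 <= p <= 1 -> (forall E, E \subset S -> F E <= G E) ->
  bmean p S F <= bmean p S G.
Proof.
move=> /andP[p0 p1] FG; apply: ler_sum => E /FG; apply: ler_wpM2l.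
by rewrite mulr_ge0 // exprn_ge0 // subr_ge0.
Qed.

Lemma bmean_subset p S B : B \subset S ->
  bmean p S (fun E => (B \subset E)%:R) = p ^+ #|B|.
Proof.
elim/finset_ind: S B => [|f S fS IH] B.
  by rewrite subset0 => /eqP ->; rewrite bmean_set0 sub0set cards0.
move=> sB; rewrite bmean_split //.
have sB' : B :\ f \subset S.
  apply/subsetP => x; rewrite !inE => /andP[xf xB].
  by move/subsetP: sB => /(_ x xB); rewrite !inE (negbTE xf).
rewrite [X in p * X](_ : _ = p ^+ #|B :\ f|); last first.
  by rewrite -IH //; apply: eq_bmean => E _; rewrite subDset.
have [fB|fB] := boolP (f \in B).
  rewrite [X in (1 - p) * X](_ : _ = 0) ?mulr0 ?addr0.
    by rewrite (cardsD1 f B) fB exprS.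
  rewrite -(bmean_cst p S 0); apply: eq_bmean => E sE.
  case: (boolP (B \subset E)) => // /subsetP/(_ f fB) fE.
  by rewrite (subsetP sE f fE) in fS.
have BE : B :\ f = B by apply/setDidPl; rewrite disjoint_sym disjoints1.
rewrite BE in sB' *; by rewrite IH // -mulrDl addrC subrK mul1r.
Qed.

(* Efron-Stein for a function with bounded differences: splitting off one
   coordinate [f] contributes [p (1 - p) (m1 - m0)^2], where [m1] and [m0] are
   the means conditional on [f] being present or absent. *)
Lemma bvar_le p S F k : 0 <= p <= 1 ->
  (forall E f, `|F (f |: E) - F E| <= k) ->
  bmean p S (fun E => (F E - bmean p S F) ^+ 2) <= #|S|%:R * p * (1 - p) * k ^+ 2.
Proof.
move=> p01 Fk; have /andP[p0 p1] := p01.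
(* In the form of second moment minus squared mean, [bmean_split] applies to each term
   separately. *)
have bvarE S' G : bmean p S' (fun E => (G E - bmean p S' G) ^+ 2) =
    bmean p S' (fun E => G E ^+ 2) - bmean p S' G ^+ 2.
  set m := bmean p S' G.
  rewrite (@eq_bmean p S' _ (fun E => G E ^+ 2 + ((- (2 * m)) * G E + m ^+ 2))).
    by rewrite !bmeanD bmeanZ bmean_cst -/m; ring.
  by move=> E _; ring.
elim/finset_ind: S F Fk => [|f S fS IH] F Fk.
  by rewrite !bmean_set0 subrr expr0n cards0 !mul0r.
have k0 : 0 <= k by apply: le_trans (Fk set0 f).
pose F1 E := F (f |: E).
have F1k E g : `|F1 (g |: E) - F1 E| <= k by rewrite /F1 setUCA.
have := IH F1 F1k; have := IH F Fk.
rewrite !bvarE !bmean_split // -/F1 cardsU1 fS add1n -natr1.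
set m0 := bmean p S F; set m1 := bmean p S F1; set N := #|S|%:R.
set v0 := bmean p S (fun E => F E ^+ 2).
set v1 := bmean p S (fun E => F (f |: E) ^+ 2) => h0 h1.
have dm : (m1 - m0) ^+ 2 <= k ^+ 2.
  have d1 : m1 - m0 <= k.
    rewrite lerBlDr -(bmean_cst p S k) -bmeanD; apply: ler_bmean => // E _.
    by rewrite -lerBlDr; apply: le_trans (ler_norm _) (Fk E f).
  have d2 : - k <= m1 - m0.
    rewrite lerBrDr -(bmean_cst p S (- k)) -bmeanD; apply: ler_bmean => // E _.
    by rewrite -lerBrDr; have := Fk E f; rewrite ler_norml => /andP[].
  by rewrite -[leLHS]real_normK ?num_real // lerXn2r ?nnegrE // ler_norml d2.
have q0 : 0 <= 1 - p by rewrite subr_ge0.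
have e0 := ler_wpM2l q0 h0; have e1 := ler_wpM2l p0 h1.
have e2 := ler_wpM2l (mulr_ge0 p0 q0) dm.
(* Law of total variance: the mean of the two conditional variances plus the variance of the
   conditional mean. *)
rewrite [leLHS](_ : _ = p * (v1 - m1 ^+ 2) + (1 - p) * (v0 - m0 ^+ 2) +
  p * (1 - p) * (m1 - m0) ^+ 2); last by rewrite -/v1; ring.
by apply: le_trans (lerD (lerD e1 e0) e2) _; rewrite le_eqVlt; apply/orP; left;
   apply/eqP; ring.
Qed.

(** The pointwise bound [|x| <= x^2 / (2 k) + k / 2] takes the place of Cauchy-Schwarz. *)
Lemma bmean_abs_le p S F k : 0 <= p <= 1 -> 0 < k ->
  bmean p S (fun E => F E ^+ 2) <= k ^+ 2 -> bmean p S (fun E => `|F E|) <= k.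
Proof.
move=> p01 k0 Fk.
apply: (@le_trans _ _ (bmean p S (fun E => (2 * k)^-1 * F E ^+ 2 + k / 2))).
  apply: ler_bmean => // E _; rewrite -[F E ^+ 2]real_normK ?num_real //.
  have : 0 <= (2 * k)^-1 * (`|F E| - k) ^+ 2.
    by rewrite mulr_ge0 ?sqr_ge0 // invr_ge0 mulr_ge0 // ltW.
  have -> : (2 * k)^-1 * (`|F E| - k) ^+ 2 =
     (2 * k)^-1 * `|F E| ^+ 2 + k / 2 - `|F E| by field; rewrite gt_eqF.
  by rewrite subr_ge0.
rewrite bmeanD bmeanZ bmean_cst.
have k2 : 0 <= (2 * k)^-1 by rewrite invr_ge0 mulr_ge0 // ltW.
have := ler_wpM2l k2 Fk.
have -> : (2 * k)^-1 * k ^+ 2 = k / 2 by field; rewrite gt_eqF.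
by move=> h; lra.
Qed.

End BinomialSubset.

(** * Effect of a single edge on the chromatic number *)

Section ChromaticNumber.
Context {n : nat}.
Implicit Types (E : {set 'I_n * 'I_n}) (e f : 'I_n * 'I_n) (u v w : 'I_n).

Lemma adjC E u v : adj E u v = adj E v u.
Proof. by rewrite /adj eq_sym orbC. Qed.

Lemma adjS E E' u v : E \subset E' -> adj E u v -> adj E' u v.
Proof.
move=> /subsetP sE /andP[uv]; rewrite /adj uv /=.
by case/orP => /sE ->; rewrite ?orbT.
Qed.

Lemma adjU1 E f u v : f != (u, v) -> f != (v, u) -> adj (f |: E) u v = adj E u v.
Proof.
by move=> f1 f2; rewrite /adj !inE ![_ == f]eq_sym (negbTE f1) (negbTE f2).
Qed.

Lemma chi_colorable E : colorable E (chi E).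
Proof. by rewrite /chi; case: ex_minnP. Qed.

Lemma chi_le E k : colorable E k -> (chi E <= k)%N.
Proof. by rewrite /chi; case: ex_minnP => m _; apply. Qed.

Lemma colorableP E k :
  reflect (exists c : 'I_n -> 'I_k, forall i j, adj E i j -> c i != c j) (colorable E k).
Proof.
apply: (iffP existsP) => [[c /forallP cP]|[c cP]].
  by exists c => i j; move/forallP: (cP i) => /(_ j)/implyP.
exists [ffun i => c i]; apply/forallP => i; apply/forallP => j; apply/implyP.
by rewrite !ffunE; exact: cP.
Qed.

Lemma chiS E E' : E \subset E' -> (chi E <= chi E')%N.
Proof.
move=> sE; apply: chi_le; have /colorableP[c cP] := chi_colorable E'.
by apply/colorableP; exists c => i j /(adjS sE); exact: cP.
Qed.

Lemma chiU1_le E f : (chi (f |: E) <= (chi E).+1)%N.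
Proof.
apply: chi_le; have /colorableP[c cP] := chi_colorable E.
apply/colorableP.
(* A new colour on the endpoint [f.1] suffices, since every new adjacency involves [f.1]. *)
exists (fun w => if w == f.1 then ord_max else widen_ord (leqnSn _) (c w)) => i j.
have neq w : widen_ord (leqnSn (chi E)) (c w) != ord_max.
  by rewrite -val_eqE /= ltn_eqF.
have [->|if1] := eqVneq i f.1; have [->|jf1] := eqVneq j f.1.
- by rewrite /adj eqxx.
- by rewrite eq_sym neq.
- by rewrite neq.
rewrite adjU1; first by move/cP; rewrite -!val_eqE.
  by apply: contra if1 => /eqP ->.
by apply: contra jf1 => /eqP ->.
Qed.

Lemma chiU1_dist (R : realType) E f : `|(chi (f |: E))%:R - (chi E)%:R : R| <= 1.
Proof.
have h1 := chiU1_le E f; have h2 : (chi E <= chi (f |: E))%N by rewrite chiS // subsetU1.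
by rewrite ger0_norm ?subr_ge0 ?ler_nat // lerBlDr addrC natr1 ler_nat.
Qed.

(** In the complement, neither vertex has a neighbour outside the pair. The adjacency of [u] and [v]
    themselves is left free, so the property survives toggling that edge. *)
Definition universal_pair E u v : bool :=
  [forall w, (w != u) && (w != v) ==> adj E u w && adj E v w].

Lemma universal_pairP E u v :
  reflect (forall w, w != u -> w != v -> adj E u w /\ adj E v w) (universal_pair E u v).
Proof.
apply: (iffP forallP) => [h w wu wv|h w].
  by have /implyP := h w; rewrite wu wv => /(_ isT)/andP.
by apply/implyP => /andP[wu wv]; apply/andP; exact: h.
Qed.

(* In any colouring of [uv |: E] the colours of [u] and [v] are used only once;
   giving [v] the colour of [u] frees a colour as soon as [uv] is deleted. *)
Lemma chiU1_universal E u v : u != v -> ~~ adj E u v -> universal_pair E u v ->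
  chi ((u, v) |: E) = (chi E).+1.
Proof.
move=> uv nadj /universal_pairP univ; apply/eqP; rewrite eqn_leq chiU1_le /=.
have : colorable ((u, v) |: E) (chi ((u, v) |: E)) := chi_colorable _.
case: (chi _) => [/colorableP[c _]|k /colorableP[c cP]]; first by case: (c u).
rewrite ltnS; apply: chi_le; apply/colorableP.
have sE : E \subset (u, v) |: E by rewrite subsetU1.
have cuv : c u != c v by apply: cP; rewrite /adj uv !inE eqxx.
pose c' w := if w == v then c u else c w.
have c'v w : c v != c' w.
  rewrite /c'; have [_|wv] := eqVneq w v; first by rewrite eq_sym.
  have [->|wu] := eqVneq w u; first by rewrite eq_sym.
  by apply: cP; apply: (adjS sE); have [] := univ w wu wv.
have c'P i j : adj E i j -> c' i != c' j.
  rewrite /c'; have [->|iv] := eqVneq i v; have [->|jv] := eqVneq j v.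
  - by rewrite /adj eqxx.
  - have [->|ju] := eqVneq j u; first by rewrite adjC (negbTE nadj).
    by move=> _; apply: cP; apply: (adjS sE); have [] := univ j ju jv.
  - have [->|iu] := eqVneq i u; first by rewrite (negbTE nadj).
    move=> _; rewrite eq_sym; apply: cP; apply: (adjS sE).
    by have [] := univ i iu iv.
  - by move=> ij; apply: cP; exact: adjS ij.
(* [c'] never takes the colour [c v]; [unlift_some] removes that value and renumbers the rest into
   ['I_k]. *)
exists (fun w => s2val (unlift_some (c'v w))) => i j /c'P; apply: contra => /eqP eij.
have := s2valP (unlift_some (c'v i)); have := s2valP (unlift_some (c'v j)).
by rewrite eij => <- <-.
Qed.

(** * Locality: adding [f] affects only the status of pairs sharing an endpoint with [f] *)

Definition touching f : {set 'I_n * 'I_n} :=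
  [set e | [|| e.1 == f.1, e.2 == f.1, e.1 == f.2 | e.2 == f.2]].

Lemma card_setI_touching (A : {set 'I_n * 'I_n}) f k :
  (forall u, #|A :&: [set e | e.1 == u]| <= k)%N ->
  (forall u, #|A :&: [set e | e.2 == u]| <= k)%N ->
  (#|A :&: touching f| <= 4 * k)%N.
Proof.
move=> h1 h2.
have -> : A :&: touching f =
  ((A :&: [set e | e.1 == f.1]) :|: (A :&: [set e | e.2 == f.1])) :|:
  ((A :&: [set e | e.1 == f.2]) :|: (A :&: [set e | e.2 == f.2])).
  by apply/setP => e; rewrite !inE; do !case: (_ == _); case: (e \in A).
have U (B C : {set 'I_n * 'I_n}) : (#|B :|: C| <= #|B| + #|C|)%N.
  by rewrite (leq_card_setU B C).
apply: leq_trans (U _ _) _; have := U (A :&: [set e | e.1 == f.1]) (A :&: [set e | e.2 == f.1]).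
have := U (A :&: [set e | e.1 == f.2]) (A :&: [set e | e.2 == f.2]).
have := h1 f.1; have := h2 f.1; have := h1 f.2; have := h2 f.2; lia.
Qed.

Lemma card_touching f : (#|touching f| <= 4 * n)%N.
Proof.
rewrite -[touching f]setTI; apply: card_setI_touching => u; rewrite setTI.
  have -> : [set e : 'I_n * 'I_n | e.1 == u]%SET = setX [set u]%SET [set: 'I_n]%SET.
    by apply/setP => e; rewrite !inE andbT.
  by rewrite cardsX cards1 cardsT card_ord mul1n.
have -> : [set e : 'I_n * 'I_n | e.2 == u]%SET = setX [set: 'I_n]%SET [set u]%SET.
  by apply/setP => e; rewrite !inE.
by rewrite cardsX cards1 cardsT card_ord muln1.
Qed.

(* In the complement of [E], these are the pairs of isolated vertices and the
   edges forming a connected component, respectively. *)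
Definition isolated_pairs E : {set 'I_n * 'I_n} :=
  [set e in upairs n | adj E e.1 e.2 && universal_pair E e.1 e.2].
Definition isolated_edges E : {set 'I_n * 'I_n} :=
  [set e in upairs n | ~~ adj E e.1 e.2 && universal_pair E e.1 e.2].

Lemma adjU1_touching E e f w : e \notin touching f ->
  adj (f |: E) e.1 w = adj E e.1 w /\ adj (f |: E) e.2 w = adj E e.2 w.
Proof.
rewrite inE !negb_or => /and4P[h1 h2 h3 h4]; rewrite !adjU1 //;
  by apply/eqP => fE; move: h1 h2 h3 h4; rewrite fE /= eqxx.
Qed.

Lemma universal_pairU1 E e f : e \notin touching f ->
  universal_pair (f |: E) e.1 e.2 = universal_pair E e.1 e.2.
Proof.
by move=> ef; apply: eq_forallb => w; have [-> ->] := adjU1_touching E w ef.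
Qed.

Lemma universal_pairU1_self E u v :
  universal_pair ((u, v) |: E) u v = universal_pair E u v.
Proof.
apply: eq_forallb => w; have [->|wu] := eqVneq w u => //.
have [->|wv] := eqVneq w v; first by rewrite andbF.
by rewrite !adjU1 // xpair_eqE negb_and ![_ == w]eq_sym ?wu ?wv ?orbT.
Qed.

Lemma isolated_pairsU1 E f :
  isolated_pairs (f |: E) :\: touching f = isolated_pairs E :\: touching f.
Proof.
apply/setP => e; rewrite ![in LHS]in_setD ![in RHS]in_setD.
case: (boolP (e \in touching f)) => //= ef.
by rewrite !inE universal_pairU1 //; have [-> _] := adjU1_touching E e.2 ef.
Qed.

Lemma isolated_edgesU1 E f :
  isolated_edges (f |: E) :\: touching f = isolated_edges E :\: touching f.
Proof.
apply/setP => e; rewrite ![in LHS]in_setD ![in RHS]in_setD.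
case: (boolP (e \in touching f)) => //= ef.
by rewrite !inE universal_pairU1 //; have [-> _] := adjU1_touching E e.2 ef.
Qed.

Lemma card_dist_setD (R : realType) (T : finType) (A B C : {set T}) k :
  A :\: C = B :\: C -> (#|A :&: C| <= k)%N -> (#|B :&: C| <= k)%N ->
  `|#|A|%:R - #|B|%:R : R| <= k%:R.
Proof.
move=> AB Ak Bk; rewrite -(cardsID C A) -(cardsID C B) AB !natrD.
rewrite opprD addrACA subrr addr0 ler_norml.
have a0 : 0 <= #|A :&: C|%:R :> R by []; have b0 : 0 <= #|B :&: C|%:R :> R by [].
by move: Ak Bk; rewrite -!(ler_nat R) => Ak Bk; apply/andP; split; lra.
Qed.

Lemma isolated_pairs_dist (R : realType) E f :
  `|#|isolated_pairs (f |: E)|%:R - #|isolated_pairs E|%:R : R| <= (4 * n)%:R.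
Proof.
apply: card_dist_setD (isolated_pairsU1 E f) _ _;
  by apply: leq_trans (card_touching f); rewrite subset_leq_card // subsetIr.
Qed.

(** Isolated edges form a matching, so at most one of them has a given first coordinate and at most
    one a given second coordinate. *)
Lemma isolated_edges_dist (R : realType) E f :
  `|#|isolated_edges (f |: E)|%:R - #|isolated_edges E|%:R : R| <= 4.
Proof.
suff touch E' : (#|isolated_edges E' :&: touching f| <= 4 * 1)%N.
  exact: card_dist_setD (isolated_edgesU1 E f) (touch _) (touch _).
have ne (i j : 'I_n) : (i < j)%N -> i != j by move=> ij; rewrite -val_eqE ltn_eqF.
apply: card_setI_touching => u; apply/card_le1_eqP => -[x y] [x' y'];
  rewrite !inE /= => /andP[/and3P[/ne xy nadj /universal_pairP univ] /eqP xu];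
  move=> /andP[/and3P[/ne xy' nadj' _] /eqP xu']; subst.
  have [->//|yy] := eqVneq y' y.
  by have [] := univ y'; rewrite ?(negbTE nadj') // eq_sym.
have [->//|xx] := eqVneq x' x.
by have [] := univ x' xx xy'; rewrite [adj E' u x']adjC (negbTE nadj').
Qed.

(** * Exchange identity and mean number of isolated pairs *)

Lemma adj_upairsN E u v : E \subset upairs n -> (u, v) \in upairs n ->
  (u, v) \notin E -> adj E u v = false.
Proof.
move=> /subsetP sE; rewrite inE /= => uv nE; rewrite /adj (negbTE nE) /=.
apply/negbTE; rewrite negb_and negbK; apply/orP; right; apply/negP => /sE.
by rewrite inE /= ltnNge (ltnW uv).
Qed.

(* Deleting the edge [e] maps the graphs with [e] an isolated pair onto those
   with [e] an isolated edge; it multiplies the weight by [(1 - p) / p] and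
   decreases the chromatic number by one. *)
Lemma isolated_exchange1 (R : realType) (p : R) (h : nat -> R) e : e \in upairs n ->
  (1 - p) * bmean p (upairs n) (fun E => (e \in isolated_pairs E)%:R * h (chi E)) =
  p * bmean p (upairs n) (fun E => (e \in isolated_edges E)%:R * h (chi E).+1).
Proof.
case: e => u v uvU; have uv : u != v.
  by move: uvU; rewrite inE /= => uv; rewrite -val_eqE ltn_eqF.
rewrite -(setD1K uvU) !bmean_split ?setD11 //; set S := _ :\ _.
(* With [(u, v)] split off, an isolated pair requires it present and an isolated edge requires it
   absent, so one branch vanishes on each side. *)
have SP E : E \subset S -> adj E u v = false.
  move=> sE; apply: adj_upairsN => //; first by apply: subset_trans sE (subD1set _ _).
  by apply/negP => /(subsetP sE); rewrite setD11.
have adjU E : adj ((u, v) |: E) u v by rewrite /adj uv !inE eqxx.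
have -> : bmean p S (fun E => ((u, v) \in isolated_pairs E)%:R * h (chi E)) = 0.
  rewrite -(bmean_cst p S 0); apply: eq_bmean => E /SP nE.
  by rewrite 2!inE /= nE andbF mul0r.
have -> : bmean p S (fun E => ((u, v) \in isolated_edges ((u, v) |: E))%:R *
    h (chi ((u, v) |: E)).+1) = 0.
  rewrite -(bmean_cst p S 0); apply: eq_bmean => E _.
  by rewrite 2!inE /= adjU andbF mul0r.
rewrite !mulr0 addr0 add0r mulrCA; congr (_ * (_ * _)); apply: eq_bmean => E /SP nE.
rewrite !inE /= adjU nE /= universal_pairU1_self.
case: (boolP (universal_pair E u v)) => [univ|_]; last by rewrite !andbF !mul0r.
by rewrite chiU1_universal // nE.
Qed.

Lemma isolated_exchange (R : realType) (p : R) (h : nat -> R) :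
  (1 - p) * bmean p (upairs n) (fun E => #|isolated_pairs E|%:R * h (chi E)) =
  p * bmean p (upairs n) (fun E => #|isolated_edges E|%:R * h (chi E).+1).
Proof.
have cardE (A : {set 'I_n * 'I_n}) k : A \subset upairs n ->
    #|A|%:R * k = \sum_(e in upairs n) (e \in A)%:R * k :> R.
  move=> /setIidPr {1}<-; rewrite -mulr_suml; congr (_ * _).
  rewrite -sum1_card natr_sum big_mkcond [RHS]big_mkcond /=.
  by apply: eq_bigr => e _; rewrite inE; do !case: (_ \in _).
rewrite (@eq_bmean _ _ _ _ _ (fun E => \sum_(e in upairs n)
  (e \in isolated_pairs E)%:R * h (chi E))); last first.
  by move=> E _; apply: cardE; apply/subsetP => e; rewrite inE => /andP[].
rewrite [in RHS](@eq_bmean _ _ _ _ _ (fun E => \sum_(e in upairs n)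
  (e \in isolated_edges E)%:R * h (chi E).+1)); last first.
  by move=> E _; apply: cardE; apply/subsetP => e; rewrite inE => /andP[].
rewrite !bmean_sum !mulr_sumr; apply: eq_bigr => e; exact: isolated_exchange1.
Qed.

(** If all pairs touching [e] are edges, then [e] is an isolated pair; at most [4 * n] edges are
    thus required. *)
Lemma isolated_pairs_mean_ge (R : realType) (p : R) : 0 <= p <= 1 ->
  #|upairs n|%:R * p ^+ (4 * n) <=
  bmean p (upairs n) (fun E => #|isolated_pairs E|%:R).
Proof.
move=> p01; have /andP[p0 p1] := p01.
apply: (@le_trans _ _ (\sum_(e in upairs n) bmean p (upairs n)
    (fun E => (upairs n :&: touching e \subset E)%:R))).
  rewrite -sum1_card natr_sum mulr_suml; apply: ler_sum => e _.
  rewrite mul1r bmean_subset ?subsetIl //; apply: ler_wiXn2l => //.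
  by apply: leq_trans (card_touching e); rewrite subset_leq_card // subsetIr.
rewrite -bmean_sum; apply: ler_bmean => // E sE.
rewrite -sum1_card natr_sum big_mkcond [leRHS]big_mkcond; apply: ler_sum => e _ /=.
case: ifP => [eU|_]; last by case: ifP.
case: (boolP (_ \subset E)) => [/subsetP sub|]; last by case: ifP.
have adjP u w : u != w -> (u == e.1) || (u == e.2) -> adj E u w.
  move=> uw ue; rewrite /adj uw /=.
  have [lt|ge] := ltnP u w.
    by rewrite sub // !inE lt /=; case/orP: ue => ->; rewrite ?orbT.
  rewrite [X in _ || X]sub ?orbT // !inE /= ltn_neqAle ge val_eqE eq_sym uw /=.
  by case/orP: ue => ->; rewrite ?orbT.
rewrite inE eU adjP ?eqxx //=; last first.
  by move: eU; rewrite inE => lt; rewrite -val_eqE ltn_eqF.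
suff -> : universal_pair E e.1 e.2 by [].
by apply/universal_pairP => w w1 w2; rewrite !adjP ?eqxx ?orbT // eq_sym.
Qed.

Lemma card_upairs_le : (#|upairs n| <= n * n)%N.
Proof. by apply: leq_trans (max_card _) _; rewrite card_prod card_ord. Qed.

(** The square is covered by [upairs n], its transpose and the diagonal. *)
Lemma card_upairs_ge : (n * n <= 2 * #|upairs n| + n)%N.
Proof.
pose sw (e : 'I_n * 'I_n) := (e.2, e.1).
pose dg (i : 'I_n) := (i, i).
have cov : [set: 'I_n * 'I_n] \subset (upairs n :|: sw @: upairs n) :|: dg @: [set: 'I_n].
  apply/subsetP => -[i j] _; rewrite !inE /=.
  case: (ltngtP i j) => //= [ji|/val_inj ->].
    by apply/orP; left; apply/imsetP; exists (j, i); rewrite ?inE.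
  by apply/orP; right; apply/imsetP; exists j; rewrite ?inE.
have := subset_leq_card cov; rewrite cardsT card_prod card_ord => /leq_trans; apply.
rewrite mul2n -addnn; apply: leq_trans (leq_card_setU _ _) _; apply: leq_add.
  apply: leq_trans (leq_card_setU _ _) _; apply: leq_add => //.
  exact: leq_imset_card.
by apply: leq_trans (leq_imset_card _ _) _; rewrite cardsT card_ord.
Qed.

End ChromaticNumber.

(** * Bounds on interval probabilities for fixed [n] *)

Section Concentration.
Context {R : realType}.
Implicit Types (p : R) (n a L : nat).

Lemma Pr_chi_inE n p a L :
  Pr_chi_in n p a L = bmean p (upairs n) (fun E => (a <= chi E <= a + L)%N%:R).
Proof.
rewrite /Pr_chi_in /Gnp_Pr big_mkcondr; apply: eq_bigr => E _.
by rewrite /Gnp_weight; case: ifP; rewrite ?mulr1 ?mulr0.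
Qed.

Lemma Pr_chi_in_le1 n p a L : 0 <= p <= 1 -> Pr_chi_in n p a L <= 1.
Proof.
move=> p01; rewrite Pr_chi_inE -[leRHS](bmean_cst p (upairs n) 1).
by apply: ler_bmean => // E _; rewrite lern1 leq_b1.
Qed.

Lemma Pr_chi_in_ge n p L (t : R) : 0 <= p <= 1 -> 0 < t -> 2 * t + 1 <= L%:R ->
  1 - n%:R ^+ 2 * (1 - p) / t ^+ 2 <=
  Pr_chi_in n p (Num.truncn (bmean p (upairs n) (fun E => (chi E)%:R) - t)) L.
Proof.
move=> p01 t0 tL; have /andP[p0 p1] := p01; rewrite Pr_chi_inE.
set m := bmean p (upairs n) (fun E => (chi E)%:R); pose a := Num.truncn (m - t); rewrite -/a.
have q0 : 0 <= 1 - p by rewrite subr_ge0.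
have ti : 0 <= (t ^+ 2)^-1 by rewrite invr_ge0 sqr_ge0.
(* Chebyshev pointwise: the indicator of the interval is at least [1 - (chi - m)^2 / t^2]. *)
apply: (@le_trans _ _ (bmean p (upairs n)
    (fun E => 1 + (- (t ^+ 2)^-1) * ((chi E)%:R - m) ^+ 2))); last first.
  apply: ler_bmean => // E _.
  case: (boolP (a <= chi E <= a + L)%N) => [_|].
    by rewrite /= [leRHS]mulr1n gerDl mulNr oppr_le0 mulr_ge0 // sqr_ge0.
  move=> out; suff : t ^+ 2 <= ((chi E)%:R - m) ^+ 2.
    move=> /(ler_wpM2l ti); rewrite mulVf ?sqrf_eq0 ?gt_eqF // => h.
    by rewrite /= [leRHS]mulr0n mulNr subr_le0.
  rewrite negb_and -!ltnNge in out; case/orP: out => h.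
    (* For negative [m - t] the truncation is [0], and no chromatic number lies below [a]. *)
    have mt : 0 <= m - t.
      rewrite leNgt; apply/negP => mt; move: h; rewrite /a truncn_floor.
      by rewrite leNgt mt.
    have [am _] := andP (truncn_itv mt); rewrite -/a in am.
    have ca : (chi E)%:R <= a%:R :> R by rewrite ler_nat ltnW.
    by nra.
  have := truncnS_gt (m - t); rewrite -/a => am.
  have : (a.+1 + L)%:R <= (chi E)%:R :> R by rewrite ler_nat addSn.
  by rewrite natrD => ca; nra.
rewrite bmeanD bmean_cst bmeanZ lerD2l mulNr lerN2 [leRHS]mulrC ler_wpM2l //.
apply: le_trans (bvar_le _ p01 (fun E f => chiU1_dist R E f)) _.
rewrite expr1n mulr1 -mulrA; have : #|upairs n|%:R <= n%:R ^+ 2 :> R.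
  by rewrite expr2 -natrM ler_nat card_upairs_le.
have N0 : 0 <= #|upairs n|%:R :> R by [].
move=> NN; apply: ler_pM => //; first by rewrite mulr_ge0.
by rewrite ler_piMl.
Qed.

(** For [q <= 1/2] one has [1 / (1 - q) <= 1 + 2 q <= exp (2 q)]. *)
Lemma exprB1_ge_expR (q : R) k : 0 <= q <= 2^-1 -> expR (- (2 * q * k%:R)) <= (1 - q) ^+ k.
Proof.
move=> /andP[q0 q1]; rewrite expRN mulrC expRM_natl.
have q2 : 0 < 1 - q by lra.
rewrite -lef_pV2 ?posrE ?invr_gt0 ?exprn_gt0 ?expR_gt0 // invrK -exprVn.
rewrite lerXn2r ?nnegrE ?invr_ge0 ?expR_ge0 ?(ltW q2) //.
apply: le_trans (expR_ge1Dx _); rewrite -[leLHS]mul1r ler_pdivrMr //; nra.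
Qed.

(* [h (k + 1) - h k] is the indicator of [a <= k <= a + L], while [h] is bounded
   by [L + 1]; [isolated_exchange] thus bounds [tau] times the probability by fluctuations. *)
Lemma Pr_chi_in_le n p a L (M : R) : 0 <= p <= 1 -> (1 < n)%N ->
  0 < 1 - p <= 2^-1 -> (1 - p) * n%:R <= M ->
  Pr_chi_in n p a L <=
  16 * (M + 1) * expR (8 * M) * L.+1%:R / (n%:R * Num.sqrt (1 - p)).
Proof.
move=> p01 n1; set q := 1 - p => /andP[q0 q2] qM; have /andP[p0 p1] := p01.
have qs : Num.sqrt q ^+ 2 = q by rewrite sqr_sqrtr // ltW.
have sq0 : 0 < Num.sqrt q by rewrite sqrtr_gt0.
have n0 : 0 < n%:R :> R by rewrite ltr0n ltnW.
set s := n%:R * Num.sqrt q.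
have s0 : 0 < s by rewrite mulr_gt0.
have s2 : s ^+ 2 = n%:R ^+ 2 * q by rewrite exprMn qs.
have M0 : 0 < M by apply: lt_le_trans qM; rewrite mulr_gt0.
pose U := upairs n.
have NU : #|U|%:R <= n%:R ^+ 2 :> R by rewrite expr2 -natrM ler_nat card_upairs_le.
pose h (k : nat) : R := (minn (k - a) L.+1)%:R.
have hS k : h k.+1 - h k = (a <= k <= a + L)%N%:R.
  rewrite /h; apply/eqP; rewrite subr_eq -natrD; apply/eqP; congr (_%:R).
  by case: (leqP a k) => /= ak; [case: (leqP k (a + L)) => /= kL|]; lia.
have hB k : `|h k| <= L.+1%:R by rewrite ger0_norm // ler_nat geq_minr.
pose T E : R := #|@isolated_pairs n E|%:R.
pose X E : R := #|@isolated_edges n E|%:R.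
pose tau := q * bmean p U T.
(* The exchange identity with [h] constantly [1]. *)
have tauX : tau = p * bmean p U X.
  have := isolated_exchange p (fun=> 1); rewrite /tau -/q.
  have m1 F : bmean p U (fun E => F E * 1) = bmean p U F.
    by apply: eq_bmean => E _; rewrite mulr1.
  by move=> H; rewrite -(m1 T) -(m1 X).
(* Here [p^(4 n) >= exp (- 8 q n) >= exp (- 8 M)], and [n^2 <= 4 |U|] because [n >= 2]. *)
have tau_ge : expR (- (8 * M)) * s ^+ 2 / 4 <= tau.
  have TM := isolated_pairs_mean_ge p01 (n := n).
  have pE : expR (- (8 * M)) <= p ^+ (4 * n).
    have -> : p = 1 - q by rewrite /q; ring.
    apply: le_trans (exprB1_ge_expR _ _); last by rewrite (ltW q0).
    by rewrite ler_expR lerN2 natrM; nra.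
  have NG : n%:R ^+ 2 <= 4 * #|U|%:R :> R.
    rewrite expr2 -natrM -[4]/(4%:R) -natrM ler_nat.
    by have := @card_upairs_ge n; rewrite -/U; nia.
  have e0 := expR_ge0 (- (8 * M)).
  have := ler_wpM2l (ltW q0) TM; apply: le_trans; rewrite s2.
  have := ler_pM e0 (sqr_ge0 (n%:R : R)) pE NG; rewrite -/U => HH.
  have := ler_wpM2l (ltW q0) HH => HHH; nra.
have dev (F : {set 'I_n * 'I_n} -> R) k : 0 < k ->
    (forall E f, `|F (f |: E) - F E| <= k) ->
    bmean p U (fun E => `|F E - bmean p U F|) <= k * s.
  move=> k0 Fk; apply: bmean_abs_le => //; first by rewrite mulr_gt0.
  apply: le_trans (bvar_le _ p01 Fk) _; rewrite exprMn mulrC.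
  rewrite ler_wpM2l ?sqr_ge0 // s2 -/q -mulrA; apply: ler_pM => //.
    by rewrite mulr_ge0 // ltW.
  by rewrite ler_piMl // ltW.
(* The prefactor [q] absorbs the Lipschitz constant [4 n], as [q n <= M]. *)
have devT : q * bmean p U (fun E => `|T E - bmean p U T|) <= 4 * M * s.
  have := dev T (4 * n)%:R; rewrite ltr0n muln_gt0 /= (ltnW n1).
  move=> /(_ isT (isolated_pairs_dist R)) /(ler_wpM2l (ltW q0)) /le_trans; apply.
  rewrite natrM mulrA ler_wpM2r ?(ltW s0) //; nra.
have devX : p * bmean p U (fun E => `|X E - bmean p U X|) <= 4 * s.
  have := dev X 4 (ltr0n _ 4) (isolated_edges_dist R) => dX.
  by apply: le_trans dX; rewrite ler_piMl //; rewrite -(bmean_cst p U 0);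
     apply: ler_bmean.
have main : tau * Pr_chi_in n p a L <= L.+1%:R * (4 * M * s + 4 * s).
  have ex : q * bmean p U (fun E => T E * h (chi E)) =
      p * bmean p U (fun E => X E * h (chi E).+1) := isolated_exchange p h.
  (* The uncentred terms cancel by [ex]. Since both means equal [tau], the centring terms leave
     [tau] times the mean of [h (chi + 1) - h chi], the indicator of the interval. *)
  have -> : tau * Pr_chi_in n p a L =
      q * bmean p U (fun E => (T E - bmean p U T) * h (chi E)) +
      p * bmean p U (fun E => - ((X E - bmean p U X) * h (chi E).+1)).
    rewrite Pr_chi_inE -/U (@eq_bmean _ _ _ _ _ (fun E => h (chi E).+1 + (-1) * h (chi E))).
      rewrite bmeanD bmeanZ.
      rewrite (@eq_bmean _ _ _ _ (fun E => (T E - _) * _)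
         (fun E => T E * h (chi E) + (- bmean p U T) * h (chi E))); last first.
        by move=> E _; ring.
      rewrite (@eq_bmean _ _ _ _ (fun E => - _)
         (fun E => (-1) * (X E * h (chi E).+1) + bmean p U X * h (chi E).+1)); last first.
        by move=> E _; ring.
      rewrite !bmeanD !bmeanZ [q * (_ + _)]mulrDr ex mulrDr {1}tauX /tau; ring.
    by move=> E _; rewrite -hS; ring.
  rewrite mulrDr; apply: lerD.
    apply: le_trans (ler_wpM2l (ler0n _ L.+1) devT); rewrite mulrCA.
    rewrite ler_wpM2l ?(ltW q0) // -bmeanZ; apply: ler_bmean => // E _.
    by apply: le_trans (ler_norm _) _; rewrite normrM mulrC ler_wpM2r.
  apply: le_trans (ler_wpM2l (ler0n _ L.+1) devX); rewrite mulrCA.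
  rewrite ler_wpM2l // -bmeanZ; apply: ler_bmean => // E _.
  by apply: le_trans (ler_norm _) _; rewrite normrN normrM mulrC ler_wpM2r.
set P := Pr_chi_in n p a L in main *.
have P0 : 0 <= P.
  by rewrite /P Pr_chi_inE -(bmean_cst p (upairs n) 0); apply: ler_bmean.
have := le_trans (ler_wpM2r P0 tau_ge) main.
rewrite expRN; have e0 : 0 < expR (8 * M) := expR_gt0 _.
move: (expR (8 * M)) e0 => e e0 H.
rewrite ler_pdivlMr //.
have c0 : 0 <= 4 * e / s by rewrite divr_ge0 ?mulr_ge0 // ltW.
have := ler_wpM2l c0 H.
rewrite (_ : 4 * e / s * (e^-1 * s ^+ 2 / 4 * P) = P * s); last first.
  by field; rewrite !gt_eqF.
rewrite (_ : 4 * e / s * (L.+1%:R * (4 * M * s + 4 * s)) =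
   16 * (M + 1) * e * L.+1%:R) //.
by field; rewrite gt_eqF.
Qed.

End Concentration.

(** * Passage to the limit in [n] *)

Local Open Scope classical_set_scope.

Lemma regime_sqrt_ge (R : realType) (D A : R) (p : nat -> R) : regime D p -> 0 < A ->
  \forall n \near \oo, A <= n%:R * Num.sqrt (1 - p n).
Proof.
move=> [p01 [/cvgryPge np _]] A0; near=> n.
have /andP[_ p1] := p01 n.
rewrite -[leLHS]ger0_norm ?(ltW A0) // -[leRHS]ger0_norm ?mulr_ge0 ?sqrtr_ge0 //.
rewrite -ler_sqr ?nnegrE // !real_normK ?num_real // exprMn sqr_sqrtr ?subr_ge0 //.
by near: n; exact: np.
Unshelve. all: by end_near. Qed.

Theorem theorem9 (R : realType) (D eps : R) : 0 < D -> 0 < eps ->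
  (* (i) *)
  (forall (p : nat -> R) (omega : nat -> R), regime D p ->
     omega @ \oo --> +oo%R ->
     exists a : nat -> nat,
       (fun n => Pr_chi_in n (p n) (a n)
                   (Num.truncn (omega n * n%:R * Num.sqrt (1 - p n)))) @ \oo --> (1 : R))
  /\
  (* (ii) *)
  (exists c : R, 0 < c /\
     forall p : nat -> R, regime D p ->
     forall a : nat -> nat, forall eta : R, 0 < eta ->
       \forall n \near \oo,
         Pr_chi_in n (p n) (a n) (Num.truncn (c * n%:R * Num.sqrt (1 - p n)))
           <= eps + eta).
Proof.
move=> D0 eps0; split.
  move=> p omega reg /cvgryPge omega_oo; have [p01 _] := reg.
  (* Deviation [t = omega s / 4] with [s = n sqrt q]: once [omega >= 1] and [s >= 4], the length
     [truncn (omega s)] is at least [2 t + 1]. The failure probability is at most [16 / omega^2]. *)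
  exists (fun n => Num.truncn (bmean (p n) (upairs n) (fun E => (chi E)%:R)
    - omega n * (n%:R * Num.sqrt (1 - p n)) / 4)).
  apply/cvgrPdist_le => e e0; near=> n.
  have : 4 <= n%:R * Num.sqrt (1 - p n) by near: n; exact: regime_sqrt_ge reg _.
  have : 1 + 16 / e <= omega n by near: n; exact: omega_oo.
  have /andP[_ p1] := p01 n.
  have s2 : (n%:R * Num.sqrt (1 - p n)) ^+ 2 = n%:R ^+ 2 * (1 - p n).
    by rewrite exprMn sqr_sqrtr // subr_ge0.
  rewrite -[omega n * n%:R * _]mulrA; move: s2; set s := n%:R * _; set w := omega n => s2 we s4.
  have e16 : 0 < 16 / e by rewrite divr_gt0.
  have w1 : 1 <= w by lra.
  rewrite ger0_norm ?subr_ge0 ?Pr_chi_in_le1 // lerBlDr addrC -lerBlDr.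
  have H := @Pr_chi_in_ge R n (p n) (Num.truncn (w * s)) (w * s / 4) (p01 n).
  apply: le_trans _ (H _ _); last first.
  - by have := truncnS_gt (w * s); rewrite -natr1; nra.
  - by nra.
  rewrite -s2 lerD2l lerN2.
  have -> : s ^+ 2 / (w * s / 4) ^+ 2 = 16 / w ^+ 2.
    by field; rewrite !gt_eqF //; lra.
  rewrite ler_pdivrMr; last by nra.
  have we2 : 16 / e <= w ^+ 2 by nra.
  by rewrite mulrC -ler_pdivrMr.
(* [M] eventually bounds [q n], because [delta n < 1]; [K] is the resulting constant in
   [Pr_chi_in_le]. *)
pose M := D + 1; pose K := 16 * (M + 1) * expR (8 * M).
have K0 : 0 < K by rewrite /K !mulr_gt0 ?expR_gt0 // /M; lra.
(* For [L <= eps s / K] the bound [K (L + 1) / s] is at most [eps + K / s], and [K / s <= eta] as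
   soon as [s >= K / eta]. *)
exists (eps / K); split; first by rewrite divr_gt0 ?K0.
move=> p reg a eta eta0; have [p01 [_ [delta [delta0 qD]]]] := reg.
near=> n.
have se : K / eta <= n%:R * Num.sqrt (1 - p n).
  by near: n; apply: regime_sqrt_ge reg _; rewrite divr_gt0.
have qM : (1 - p n) * n%:R <= M.
  have : (1 - p n) * n%:R <= D + delta n by near: n.
  have : `|delta n| < 1 by near: n; exact: cvgr0_norm_lt.
  by rewrite ltr_norml /M => /andP[_ d1]; lra.
(* As [M > 1], this gives both [n > 1] and, with [qM], [q <= 1/2]. *)
have nM : 2 * M <= n%:R by near: n; exact: nbhs_infty_ger.
have /andP[_ p1] := p01 n.
have s0 : 0 < n%:R * Num.sqrt (1 - p n) by apply: lt_le_trans se; rewrite divr_gt0.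
have q0 : 0 < 1 - p n.
  rewrite lt_neqAle subr_ge0 p1 andbT; apply/eqP => q0.
  by move: s0; rewrite -q0 sqrtr0 mulr0 ltxx.
have q2 : 1 - p n <= 2^-1.
  by have M1 : 1 < M by [rewrite /M; lra]; nra.
have n1 : (1 < n)%N by rewrite -(ltr_nat R); rewrite /M in nM; lra.
rewrite -[eps / K * n%:R * _]mulrA.
apply: le_trans (Pr_chi_in_le _ _ (p01 n) n1 _ qM) _; first by rewrite q0.
rewrite -/K; move: s0 se; set s := n%:R * _ => s0 se.
rewrite ler_pdivrMr //.
have cs : 0 <= eps / K * s by rewrite mulr_ge0 ?divr_ge0 // ltW.
have /andP[tc _] := truncn_itv cs.
rewrite -natr1; have := ler_wpM2l (ltW K0) tc.
rewrite (_ : K * (eps / K * s) = eps * s); last by field; rewrite gt_eqF.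
by move: se; rewrite ler_pdivrMr //; nra.
Unshelve. all: by end_near. Qed.
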